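(* Let $\Lambda=\mathrm{diag}(\lambda_1,\dots,\lambda_n)$ with $\lambda_1<\dots<\lambda_n$, and let $g:\mathbb{R}\to\mathbb{R}$ be a smooth function with $g(\lambda_i)\neq g(\lambda_j)$ for all $i\neq j$. Let $X_g$ be the vector field on $\mathcal{T}_\Lambda$ given by $X_g(T)=[T,\Pi_a g(T)]$. Let $M=\mathrm{diag}(\mu_1,\dots,\mu_n)$ with $\mu_1>\mu_2>\dots>\mu_n$ and let $h_{M,g}:\mathcal{T}_\Lambda\to\mathbb{R}$ be $h_{M,g}(T)=\mathrm{tr}(M\,g(T))$. Then the directional derivative $X_g h_{M,g}$ is strictly positive at every non-diagonal $T\in\mathcal{T}_\Lambda$.
   Context: $\mathcal{T}_\Lambda$ denotes the set of real symmetric tridiagonal $n\times n$ matrices with spectrum $\{\lambda_1,\dots,\lambda_n\}$ (a smooth manifold). For a square matrix $A$, $\Pi_a A$ denotes the unique skew-symmetric matrix $S$ with $S_{ij}=A_{ij}$ for $i>j$. $g(T)$ is the matrix function defined by functional calculus. $[A,B]=AB-BA$. The vector field $X_g$ is tangent to $\mathcal{T}_\Lambda$. *)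

(* Defs.v *)
From mathcomp Require Import all_boot all_order all_algebra.
From mathcomp Require Import all_classical all_reals all_analysis.
Set Implicit Arguments. Unset Strict Implicit. Unset Printing Implicit Defensive.
Import Order.TTheory GRing.Theory Num.Theory.
Local Open Scope ring_scope.
Local Open Scope classical_set_scope.

Section Defs.
Variable R : realType.

Definition smooth_fun (g : R -> R) : Prop :=
  forall (k : nat) (x : R), derivable (derive1n k g) x 1.

Definition spectral_decomp n (A : 'M[R]_n) (p : 'M[R]_n * 'rV[R]_n) : Prop :=
  p.1 *m p.1^T = 1%:M /\ A = p.1 *m diag_mx p.2 *m p.1^T.

(* functional calculus g(A) for a real symmetric matrix A:
   g(A) = Q diag(g(d_1),...,g(d_n)) Q^T for an orthogonal diagonalization
   (chosen with classical choice; well defined independently of the choice) *)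
Definition matfun n (g : R -> R) (A : 'M[R]_n) : 'M[R]_n :=
  let p := xget (0, 0) (spectral_decomp A) in
  p.1 *m diag_mx (map_mx g p.2) *m p.1^T.

Definition Pi_a n (A : 'M[R]_n) : 'M[R]_n :=
  \matrix_(i, j) (if (j < i)%N then A i j
                  else if (i < j)%N then - A j i else 0).

Definition commutator n (A B : 'M[R]_n) : 'M[R]_n := A *m B - B *m A.

Definition symmetric n (T : 'M[R]_n) : Prop := T^T = T.

Definition tridiagonal n (T : 'M[R]_n) : Prop :=
  forall i j : 'I_n, (i.+1 < j)%N \/ (j.+1 < i)%N -> T i j = 0.

Definition in_T_Lambda n (lam : 'I_n -> R) (T : 'M[R]_n) : Prop :=
  symmetric T /\ tridiagonal T /\
  (forall a : R, eigenvalue T a <-> exists i : 'I_n, a = lam i).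

Definition X_g n (g : R -> R) (T : 'M[R]_n) : 'M[R]_n :=
  commutator T (Pi_a (matfun g T)).

Definition h_Mg n (mu : 'I_n -> R) (g : R -> R) (T : 'M[R]_n) : R :=
  \tr (diag_mx (\row_i mu i) *m matfun g T).

Definition diagonal_mx_p n (T : 'M[R]_n) : Prop :=
  forall i j : 'I_n, i != j -> T i j = 0.

End Defs.

(* Main.v *)
Require Import Defs.
From mathcomp Require Import all_boot all_order all_algebra.
From mathcomp Require Import all_classical all_reals all_analysis.
From mathcomp Require Import complex ring lra.
Import Order.TTheory GRing.Theory Num.Theory.
Local Open Scope ring_scope.
Local Open Scope classical_set_scope.
Set Implicit Arguments. Unset Strict Implicit. Unset Printing Implicit Defensive.

(* Write G = g(T), S = Pi_a G and X = [T, S]. The point is that t |-> g(T + t X)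
   is differentiable at 0 with derivative [G, S], although T + t X is only
   tangent to the isospectral manifold. With L = 1 + t S one has the exact
   identity L (T + t X) - T L = t^2 S X. For symmetric A, B and any L,
   |L g(A) - g(B) L| <= Lip(g) |L A - B L| in Frobenius norm, since in
   eigenbases both sides multiply the same matrix entrywise, by
   g(a_j) - g(b_i) and a_j - b_i respectively. Hence L g(T + t X) - G L = O(t^2),
   which is the claimed expansion.
   The derivative is then tr(M [G, S]) = 2 sum_(i < j) (mu_i - mu_j) G_ij^2,
   and this is positive because g is injective on the spectrum, so that a
   diagonal G would force T to be diagonal. *)

(** * Spectral theorem for real symmetric matrices *)

(** Over the complex numbers an eigenvalue [a] exists; evaluating [v A v^*] in two ways gives
    [a |v|^2 = conj a |v|^2], so [a] is real. *)
Lemma symmetric_has_eigenvalue (R : rcfType) n (A : 'M[R]_n.+1) :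
  A^T = A -> exists r, eigenvalue A r.
Proof.
move=> symA.
pose f : {rmorphism R -> complex R} := real_complex R.
have [a ea] := spectral.eigenvalue_closed (map_mx f A) isT.
have : a \is Num.real.
  have /eigenvalueP[v vA vn0] := ea.
  pose w := (map_mx Num.conj v)^T.
  have fw : map_mx f A *m w = Num.conj a *: w.
    apply: trmx_inj; rewrite /w trmx_mul trmxK [(map_mx f A)^T]map_trmx symA.
    rewrite linearZ /= trmxK.
    rewrite -map_mxZ -vA map_mxM; congr (_ *m _).
    apply/matrixP => i j; rewrite !mxE; apply/esym/CrealP/complex_realP.
    by exists (A i j).
  have : a *: (v *m w) = Num.conj a *: (v *m w).
    by rewrite scalemxAl -vA -mulmxA fw scalemxAr.
  move/matrixP/(_ 0 0); rewrite !mxE => /mulIf e.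
  apply/CrealP/esym/e.
  apply/eqP => /eqP; rewrite psumr_eq0 => [|i _]; last first.
    by rewrite !mxE mul_conjC_ge0.
  move/allP => z; case/negP: vn0; apply/eqP/rowP => j; rewrite mxE.
  by have := z j (mem_index_enum j); rewrite !mxE /= mul_conjC_eq0 => /eqP.
move=> /complex_realP[r er]; exists r.
by move: ea; rewrite er -[X in eigenvalue _ X]/(f r) eigenvalue_map.
Qed.

(** The reflection is symmetric, and it squares to the identity because [w^T w] squares to
    [c w^T w]. *)
Lemma reflection_orthogonal (F : fieldType) n (w : 'rV[F]_n) c :
  w *m w^T = c%:M -> c != 0 ->
  (1%:M - (2 / c) *: (w^T *m w)) *m (1%:M - (2 / c) *: (w^T *m w))^T = 1%:M.
Proof.
move=> ww c0.
have -> : (1%:M - (2 / c) *: (w^T *m w))^T = 1%:M - (2 / c) *: (w^T *m w).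
  rewrite [LHS]raddfB /= trmx1; congr (_ - _).
  by rewrite [LHS]linearZ /= trmx_mul trmxK.
rewrite mulmxBl !mulmxBr !mul1mx mulmx1 -scalemxAl -scalemxAr.
rewrite mulmxA -(mulmxA w^T w) ww -mulmxA mul_scalar_mx -scalemxAr !scalerA.
rewrite -addrA -opprD -scalerBl -scalerDl.
have -> : 2 / c + (2 / c - 2 / c * (2 / c * c)) = 0 by field.
by rewrite scale0r subr0.
Qed.

(* The reflection exchanging [u] and the first basis vector. *)
Lemma householder (R : realFieldType) n (u : 'rV[R]_n.+1) :
  u *m u^T = 1%:M ->
  exists2 P : 'M[R]_n.+1, P *m P^T = 1%:M & delta_mx 0 0 *m P = u.
Proof.
move=> uu; pose e : 'rV[R]_n.+1 := delta_mx 0 0.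
have [->|une] := eqVneq u e.
  by exists 1%:M; rewrite ?trmx1 ?mulmx1.
pose w := u - e; pose c := (w *m w^T) 0 0.
have ww : w *m w^T = c%:M by rewrite [LHS]mx11_scalar.
have ue : u *m e^T = (u 0 0)%:M by rewrite trmx_delta -colE [LHS]mx11_scalar mxE.
have eu : e *m u^T = (u 0 0)%:M by rewrite -rowE [LHS]mx11_scalar !mxE.
have ee : e *m e^T = 1%:M by rewrite trmx_delta mul_delta_mx [LHS]mx11_scalar mxE.
have cE : c = 2 - 2 * u 0 0.
  rewrite /c /w linearB /= mulmxBl !mulmxBr uu ue eu ee !mxE eqxx /=; lra.
have c0 : c != 0.
  apply/eqP => c0; case/negP: une; rewrite -subr_eq0; apply/eqP/rowP => j.
  move: c0 => /eqP; rewrite /c mxE psumr_eq0 => [|i _]; last first.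
    by rewrite [w^T _ _]mxE -expr2 sqr_ge0.
  move/allP/(_ j (mem_index_enum j)); rewrite [w^T _ _]mxE /= -expr2 sqrf_eq0.
  by move/eqP => ->; rewrite mxE.
exists (1%:M - (2 / c) *: (w^T *m w)).
  exact: reflection_orthogonal.
rewrite mulmxBr mulmx1 -scalemxAr mulmxA -/e.
(* This scalar is [- c / 2], so the reflection sends [e] to [e + w = u]. *)
have -> : e *m w^T = (u 0 0 - 1)%:M by rewrite linearB /= mulmxBr eu ee -raddfB.
rewrite mul_scalar_mx scalerA.
have -> : 2 / c * (u 0 0 - 1) = -1 by rewrite cE; move: c0; rewrite cE => c0; field.
by rewrite scaleN1r opprK /w addrC subrK.
Qed.

(** Induction on the size: with a unit eigenvector as first row of an orthogonal [P], the first row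
    of [P A P^T] is [r] times a basis vector. By symmetry so is the first column, and a smaller
    symmetric block remains. *)
Lemma real_spectral (R : realType) n (A : 'M[R]_n) :
  A^T = A -> exists p, spectral_decomp A p.
Proof.
elim: n A => [|n IH] A symA.
  by exists (0, 0); split; rewrite [LHS]flatmx0 [RHS]flatmx0.
have [r /eigenvalueP[v vA vn0]] := symmetric_has_eigenvalue symA.
pose c := (v *m v^T) 0 0.
have c0 : 0 < c.
  rewrite lt_neqAle /c mxE sumr_ge0 => [|i _]; last by rewrite !mxE -expr2 sqr_ge0.
  rewrite andbT eq_sym psumr_eq0 => [|i _]; last by rewrite !mxE -expr2 sqr_ge0.
  apply: contra vn0 => /allP z; apply/eqP/rowP => j; rewrite mxE.
  by have := z j (mem_index_enum j); rewrite !mxE /= -expr2 sqrf_eq0 => /eqP.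
pose u := (Num.sqrt c)^-1 *: v.
have uu : u *m u^T = 1%:M.
  rewrite linearZ /= -scalemxAl -scalemxAr scalerA [v *m _]mx11_scalar -/c.
  rewrite scale_scalar_mx -invfM -expr2 sqr_sqrtr ?(ltW c0)// mulVf//.
  by rewrite gt_eqF.
have uA : u *m A = r *: u by rewrite -scalemxAl vA !scalerA mulrC.
have [P PP eP] := householder uu.
have PP' : P^T *m P = 1%:M by apply: mulmx1C.
pose B : 'M[R]_(1 + n) := P *m A *m P^T.
have symB : B^T = B by rewrite /B !trmx_mul symA trmxK mulmxA.
have eB : usubmx B = row_mx r%:M 0.
  have -> : usubmx B = delta_mx 0 0 *m B.
    rewrite -rowE; apply/matrixP => i j; rewrite [LHS]mxE [RHS]mxE.
    by congr (B _ _); apply/val_inj; rewrite /= (ord1 i).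
  rewrite /B !mulmxA eP uA -scalemxAl -eP -mulmxA PP mulmx1.
  apply/matrixP => i j; rewrite (ord1 i).
  case: (split_ordP j) => k ->; rewrite ?row_mxEl ?row_mxEr !mxE ?(ord1 k).
    by rewrite !eqxx mulr1 mulr1n.
  by rewrite mulr0.
have BE : B = block_mx r%:M 0 0 (drsubmx B).
  have <- : ulsubmx B = r%:M by rewrite /ulsubmx eB row_mxKl.
  have ur : ursubmx B = 0 by rewrite /ursubmx eB row_mxKr.
  have dl : dlsubmx B = 0 by rewrite -symB -trmx_ursub ur trmx0.
  by rewrite -[in X in block_mx _ X]ur -[X in block_mx _ _ X]dl submxK.
have [|[Q d] [/= QQ QE]] := IH (drsubmx B).
  by rewrite trmx_drsub symB.
pose Q1 : 'M[R]_(1 + n) := block_mx 1%:M 0 0 Q.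
have Q11 : Q1 *m Q1^T = 1%:M.
  rewrite tr_block_mx mulmx_block !trmx0 trmx1 !(mulmx0, mul0mx, mulmx1) addr0 !add0r.
  by rewrite QQ -scalar_mx_block.
have BD : B = Q1 *m diag_mx (row_mx r%:M d) *m Q1^T.
  rewrite BE diag_mx_row tr_block_mx !mulmx_block !trmx0 trmx1.
  rewrite !(mulmx0, mul0mx, mulmx1, mul1mx) !addr0 !add0r -QE.
  by congr block_mx; rewrite ?mul0mx //; apply/matrixP => i j; rewrite !mxE !ord1.
exists (P^T *m Q1, row_mx r%:M d); split => /=.
  by rewrite trmx_mul trmxK mulmxA -(mulmxA P^T) Q11 mulmx1.
rewrite trmx_mul trmxK mulmxA -!(mulmxA P^T) !mulmxA.
rewrite -(mulmxA P^T) -(mulmxA P^T) -BD /B.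
by rewrite !mulmxA PP' mul1mx -mulmxA PP' mulmx1.
Qed.

(** * Frobenius norm estimates *)

Definition sqfrob (R : comNzRingType) n (A : 'M[R]_n) : R := \tr (A *m A^T).

Lemma sqfrobE (R : comNzRingType) n (A : 'M[R]_n) :
  sqfrob A = \sum_i \sum_j A i j ^+ 2.
Proof.
apply: eq_bigr => i _; rewrite mxE; apply: eq_bigr => j _.
by rewrite [A^T _ _]mxE expr2.
Qed.

Lemma sqfrob_orthogonal (R : comNzRingType) n (P Q A : 'M[R]_n) :
  P^T *m P = 1%:M -> Q *m Q^T = 1%:M -> sqfrob (P *m A *m Q) = sqfrob A.
Proof.
move=> PP QQ; rewrite /sqfrob !trmx_mul !mulmxA -(mulmxA _ Q) QQ mulmx1.
by rewrite -!mulmxA mxtrace_mulC -!mulmxA PP mulmx1.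
Qed.

Lemma sqfrobZ (R : comNzRingType) n (c : R) (A : 'M[R]_n) :
  sqfrob (c *: A) = c ^+ 2 * sqfrob A.
Proof.
by rewrite /sqfrob linearZ /= -scalemxAl -scalemxAr scalerA mxtraceZ expr2.
Qed.

Lemma entry_le_frob (R : rcfType) n (A : 'M[R]_n) i j :
  `|A i j| <= Num.sqrt (sqfrob A).
Proof.
rewrite -sqrtr_sqr ler_wsqrtr // sqfrobE (bigD1 i) //= (bigD1 j) //= -addrA.
rewrite lerDl addr_ge0 ?sumr_ge0 // => *; rewrite ?sqr_ge0 //.
by apply: sumr_ge0 => *; apply: sqr_ge0.
Qed.

(** Crude, but the constant depends on [C] alone, which stays fixed while [t] varies in the later
    estimate. *)
Lemma mxtrace_le_frob (R : rcfType) n (C A : 'M[R]_n) :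
  `|\tr (C *m A)| <= (\sum_i \sum_j `|C i j|) * Num.sqrt (sqfrob A).
Proof.
rewrite mulr_suml; apply: le_trans (ler_norm_sum _ _ _) _; apply: ler_sum => i _.
rewrite mxE mulr_suml; apply: le_trans (ler_norm_sum _ _ _) _.
by apply: ler_sum => j _; rewrite normrM ler_wpM2l // entry_le_frob.
Qed.

(* In the two eigenbases, [L f(A) - f(B) L] has the entries
   [(f a_j - f b_i) W_ij] with [W = Q^T L P]. *)
Lemma intertwine_lipschitz (R : realType) n (f : R -> R) (k : R)
    (A B L : 'M[R]_n) p q :
  spectral_decomp A p -> spectral_decomp B q ->
  (forall i j, `|f (p.2 0 j) - f (q.2 0 i)| <= k * `|p.2 0 j - q.2 0 i|) ->
  let F r := r.1 *m diag_mx (map_mx f r.2) *m r.1^T in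
  sqfrob (L *m F p - F q *m L) <= k ^+ 2 * sqfrob (L *m A - B *m L).
Proof.
move: p q => [P a] [Q b] [/= PP ->] [/= QQ ->] lipf.
have PP' : P^T *m P = 1%:M by apply: mulmx1C.
have QQ' : Q^T *m Q = 1%:M by apply: mulmx1C.
pose W := Q^T *m L *m P.
have entries (h : R -> R) :
    sqfrob (L *m (P *m diag_mx (map_mx h a) *m P^T)
            - Q *m diag_mx (map_mx h b) *m Q^T *m L) =
    \sum_i \sum_j ((h (a 0 j) - h (b 0 i)) * W i j) ^+ 2.
  rewrite -(@sqfrob_orthogonal _ _ Q^T P) ?trmxK // sqfrobE.
  rewrite mulmxBr mulmxBl.
  have -> : Q^T *m (L *m (P *m diag_mx (map_mx h a) *m P^T)) *m P =
            W *m diag_mx (map_mx h a).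
    by rewrite /W !mulmxA -!(mulmxA _ P^T) PP' mulmx1.
  have -> : Q^T *m (Q *m diag_mx (map_mx h b) *m Q^T *m L) *m P =
            diag_mx (map_mx h b) *m W.
    by rewrite /W !mulmxA QQ' mul1mx.
  apply: eq_bigr => i _; apply: eq_bigr => j _.
  by rewrite mul_mx_diag mul_diag_mx !mxE; congr (_ ^+ 2); ring.
(* For [h = id] the identity describes [L A - B L], so the two sides can be compared entry by
   entry. *)
have entries_id := entries id; rewrite !map_mx_id // in entries_id.
rewrite entries entries_id.
rewrite mulr_sumr; apply: ler_sum => i _; rewrite mulr_sumr; apply: ler_sum => j _.
have -> : k ^+ 2 * ((a 0 j - b 0 i) * W i j) ^+ 2 =
          (k * (a 0 j - b 0 i)) ^+ 2 * W i j ^+ 2.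
  by rewrite !exprMn; ring.
rewrite exprMn ler_wpM2r ?sqr_ge0 //.
rewrite -[leLHS]real_normK ?num_real // -[leRHS]real_normK ?num_real //.
have h := lipf i j.
rewrite lerXn2r ?nnegrE ?normr_ge0 //.
by rewrite normrM (le_trans h) // ler_wpM2r // ler_norm.
Qed.

(** Eigenvalues are diagonal entries of a matrix with the same Frobenius norm. This will confine the
    spectra of all [T + t X] with [|t| <= 1] to one interval. *)
Lemma spectral_decomp_bound (R : realType) n (A : 'M[R]_n) p i :
  spectral_decomp A p -> `|p.2 0 i| <= Num.sqrt (sqfrob A).
Proof.
case: p => P a [/= PP ->].
rewrite sqfrob_orthogonal ?trmxK //; first last; try exact: mulmx1C.
by apply: le_trans (entry_le_frob _ i i); rewrite !mxE eqxx mulr1n.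
Qed.

(** * Lipschitz bounds and derivatives on the real line *)

Section RealAnalysis.
Import numFieldNormedType.Exports.

(** The derivative is continuous, being differentiable, so its extreme values on [[-c, c]] bound it
    there, and the mean value theorem applies. *)
Lemma C1_lipschitz_on (R : realType) (f : R -> R) (c : R) :
  (forall x, derivable f x 1) -> (forall x, derivable f^`() x 1) ->
  exists2 k, 0 <= k & forall x y, `|x| <= c -> `|y| <= c -> `|f x - f y| <= k * `|x - y|.
Proof.
move=> df ddf.
have [c0|c0] := ltP c 0.
  by exists 0 => // x y xc _; move: (lt_le_trans c0 (normr_ge0 x)); rewrite ltNge xc.
have cc : - c <= c by lra.
have cont (h : R -> R) (I : interval R) :
    (forall x, derivable h x 1) -> {within [set` I], continuous h}.
  by move=> dh; apply: derivable_within_continuous => x _.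
have [M _ fM] := EVT_max cc (cont _ _ ddf).
have [m _ fm] := EVT_min cc (cont _ _ ddf).
exists (`|derive1 f M| + `|derive1 f m|); first by rewrite addr_ge0.
move=> x y; wlog xy : x y / x <= y.
  move=> H xc yc; have [xy|/ltW xy] := leP x y; first exact: H.
  by rewrite distrC (distrC x); apply: H.
move=> xc yc.
have [z|z zi e] := MVT_segment xy _ (cont _ _ df) (df := f^`()).
  by move=> _; split; [exact: df | rewrite derive1E].
rewrite distrC e normrM (distrC x) ler_wpM2r //.
have zc : z \in `[-c, c]%R.
  move: xc yc zi; rewrite !ler_norml !in_itv /= => /andP[? ?] /andP[? ?] /andP[? ?].
  by apply/andP; split; lra.
have := fM _ zc; have := fm _ zc.
have := ler_norm (derive1 f M); have := ler_norm (- derive1 f m); rewrite normrN.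
have := normr_ge0 (derive1 f M); have := normr_ge0 (derive1 f m).
move=> ? ? ? ? ? ?; rewrite ler_norml; apply/andP;split; lra.
Qed.

Lemma derive1_of_quadratic_error (R : realType) (f : R -> R) (c k : R) :
  (forall t, `|t| <= 1 -> `|f t - f 0 - t * c| <= k * t ^+ 2) ->
  derivable f 0 1 /\ f^`() 0 = c.
Proof.
move=> fk.
have k0 : 0 <= k.
  by have := fk 1; rewrite normr1 expr1n mulr1 => /(_ (lexx _)); apply: le_trans.
have cv : (fun h : R => h^-1 *: ((f \o shift 0) (h *: 1) - f 0)) @ 0^' --> c.
  apply/cvgrPdist_le => e e0; near=> h.
  have h0 : h != 0 by near: h; exact: nbhs_dnbhs_neq.
  (* Adding 1 keeps the denominator positive when [k = 0]; the difference quotient is then within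
     [k |h| <= e] of [c]. *)
  have hd : `|h| <= Num.min 1 (e / (k + 1)).
    near: h; apply: nbhs_dnbhs; apply: (@nbhs0_le R R).
    by rewrite lt_min ltr01 divr_gt0 // ltr_wpDl.
  move: hd; rewrite le_min => /andP[h1]; rewrite ler_pdivlMr ?ltr_wpDl // => he.
  rewrite /= addr0 [h *: 1]mulr1 distrC.
  have -> : h^-1 *: (f h - f 0) - c = h^-1 * (f h - f 0 - h * c).
    by rewrite [in RHS]mulrBr mulKf.
  rewrite normrM normfV ler_pdivrMl ?normr_gt0 //.
  apply: le_trans (fk _ h1) _.
  rewrite -real_normK ?num_real // expr2 mulrCA ler_wpM2l // mulrC.
  by apply: le_trans he; rewrite ler_wpM2l // lerDl.
split; first by apply/cvg_ex; exists c.
by rewrite derive1E; apply: cvg_lim cv.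
Unshelve. all: by end_near. Qed.

End RealAnalysis.

(** * First-order expansion of the functional calculus *)

(** Existence of a decomposition rules out the default [(0, 0)] of [xget]. *)
Lemma matfunP (R : realType) n (f : R -> R) (A : 'M[R]_n) :
  A^T = A -> exists2 p, spectral_decomp A p &
    matfun f A = p.1 *m diag_mx (map_mx f p.2) *m p.1^T.
Proof.
move=> /real_spectral ex; exists (xget (0, 0) (spectral_decomp A)) => //.
by case: ex => p; exact: xgetI.
Qed.

Lemma matfun_sym (R : realType) n (f : R -> R) (A : 'M[R]_n) :
  A^T = A -> (matfun f A)^T = matfun f A.
Proof.
move=> /(matfunP f)[p _ ->].
by rewrite !trmx_mul trmxK tr_diag_mx mulmxA.
Qed.

Lemma Pi_a_skew (R : realType) n (A : 'M[R]_n) : (Pi_a A)^T = - Pi_a A.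
Proof.
by apply/matrixP => i j; rewrite !mxE; case: ltngtP; rewrite ?opprK ?oppr0.
Qed.

Lemma commutator_sym (R : realType) n (A S : 'M[R]_n) :
  A^T = A -> S^T = - S -> (commutator A S)^T = commutator A S.
Proof.
move=> symA skewS; rewrite /commutator [LHS]raddfB /= !trmx_mul symA skewS.
by rewrite mulNmx mulmxN opprK addrC.
Qed.

(* With [L = 1 + t S] and [A = T + t [T,S]] one has [L A - T L = t^2 S [T,S]],
   so [L g(A) - g(T) L] is quadratic in [t] as well. *)
Lemma matfun_commutator_expansion (R : realType) n (f : R -> R) (T S C : 'M[R]_n) :
  (forall x, derivable f x 1) -> (forall x, derivable (derive1 f) x 1) ->
  T^T = T -> S^T = - S ->
  exists k, forall t, `|t| <= 1 ->
    `|\tr (C *m (matfun f (T + t *: commutator T S) - matfun f T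
                 - t *: commutator (matfun f T) S))| <= k * t ^+ 2.
Proof.
move=> df ddf symT skewS; set X := commutator T S; set G := matfun f T.
have symX : X^T = X by exact: commutator_sym.
(* [c] bounds the norm of [T + t X] for all [|t| <= 1], so a single Lipschitz constant serves all
   these [t]. *)
pose c := Num.sqrt (\sum_i \sum_j (`|T i j| + `|X i j|) ^+ 2).
have boundA t : `|t| <= 1 -> Num.sqrt (sqfrob (T + t *: X)) <= c.
  move=> t1; rewrite ler_wsqrtr // sqfrobE; apply: ler_sum => i _; apply: ler_sum => j _.
  rewrite -[leLHS]real_normK ?num_real // lerXn2r ?nnegrE ?addr_ge0 //.
  rewrite !mxE (le_trans (ler_normD _ _)) // lerD2l normrM.
  by rewrite ler_piMl.
have [k k0 lip] := C1_lipschitz_on c df ddf.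
pose N (Z : 'M[R]_n) := \sum_i \sum_j `|Z i j|.
pose s (Z : 'M[R]_n) := Num.sqrt (sqfrob Z).
(* The two terms match the splitting of the remainder into [L gA - G L] and [- t S (gA - G)], each
   of order [t^2]. *)
exists (k * (N C * s (S *m X) + N (C *m S) * s X)) => t t1.
pose A := T + t *: X; set gA := matfun f A.
have symA : A^T = A by rewrite /A raddfD /= linearZ /= symT symX.
have [p pA gAE] := matfunP f symA; have [q qT GE] := matfunP f symT.
have est (L : 'M[R]_n) : s (L *m gA - G *m L) <= k * s (L *m A - T *m L).
  rewrite -[k]ger0_norm // -sqrtr_sqr -sqrtrM ?sqr_ge0 // ler_wsqrtr //.
  rewrite /gA gAE /G GE; apply: (@intertwine_lipschitz _ _ f k A T L p q pA qT) => i j.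
  apply: lip; first exact: le_trans (spectral_decomp_bound j pA) (boundA _ t1).
  apply: le_trans (spectral_decomp_bound i qT) _.
  by have := boundA 0; rewrite scale0r addr0 normr0; apply.
have sZ a (Z : 'M[R]_n) : s (a *: Z) = `|a| * s Z.
  by rewrite /s sqfrobZ sqrtrM ?sqr_ge0 // sqrtr_sqr.
pose L := 1%:M + t *: S.
have LA : L *m A - T *m L = t ^+ 2 *: (S *m X).
  rewrite /L /A mulmxDl mul1mx (mulmxDr T) (mulmxDr (t *: S)) mulmx1.
  rewrite -!scalemxAl -!scalemxAr scalerA -expr2; move: (S *m X) => Y.
  by rewrite /X /commutator; apply/matrixP => i j; rewrite !mxE; ring.
have E1 := est L; rewrite LA sZ in E1.
(* Taking [L = 1] gives the plain Lipschitz bound on [gA - G], of order [t]; the factor [t] in front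
   of the second term supplies the other power. *)
have E2 := est 1%:M; rewrite !mul1mx !mulmx1 addrAC subrr add0r sZ in E2.
have -> : gA - G - t *: commutator G S = (L *m gA - G *m L) - t *: (S *m (gA - G)).
  rewrite /L /commutator mulmxDl mulmxDr mul1mx mulmx1 -!scalemxAl -!scalemxAr mulmxBr.
  by apply/matrixP => i j; rewrite !mxE; ring.
rewrite mulmxBr raddfB /= -scalemxAr mxtraceZ (mulmxA C S).
apply: le_trans (ler_normB _ _) _; rewrite normrM.
have N0 Z : 0 <= N Z by rewrite /N; do 2![apply: sumr_ge0 => ? _].
have B1 := mxtrace_le_frob C (L *m gA - G *m L).
have B2 := mxtrace_le_frob (C *m S) (gA - G).
rewrite ger0_norm ?sqr_ge0 // in E1.
have {}B1 := le_trans B1 (ler_wpM2l (N0 C) E1).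
have {}B2 := ler_wpM2l (normr_ge0 t) (le_trans B2 (ler_wpM2l (N0 (C *m S)) E2)).
apply: le_trans (lerD B1 B2) _.
rewrite le_eqVlt; apply/orP; left; apply/eqP.
by rewrite -[t ^+ 2]real_normK ?num_real //; rewrite -/(N C); ring.
Qed.

(** * Positivity of the trace *)

(** The diagonal of the commutator contributes [2 mu_i H_ij] with [H_ij = - G_ij S_ij]. As [H] is
    skew, exchanging [i] and [j] in one of the two copies yields the factor [mu_i - mu_j]. *)
Lemma mxtrace_Toda_sum (R : realType) n (mu : 'I_n -> R) (G : 'M[R]_n) :
  G^T = G ->
  \tr (diag_mx (\row_i mu i) *m commutator G (Pi_a G)) =
  \sum_i \sum_j (mu i - mu j) * - (G i j * Pi_a G i j).
Proof.
move=> symG; set S := Pi_a G.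
have Gs i j : G j i = G i j by rewrite -[in LHS]symG mxE.
have Ss i j : S j i = - S i j by have /matrixP/(_ i j) := Pi_a_skew G; rewrite !mxE.
pose H i j := - (G i j * S i j).
have Hs i j : H j i = - H i j by rewrite /H Gs Ss mulrN.
have -> : \sum_i \sum_j (mu i - mu j) * H i j =
          \sum_i \sum_j mu i * H i j + \sum_i \sum_j mu i * H i j.
  rewrite [X in _ = _ + X]exchange_big -big_split; apply: eq_bigr => i _ /=.
  by rewrite -big_split; apply: eq_bigr => j _ /=; rewrite [H j i]Hs; ring.
rewrite -big_split; apply: eq_bigr => i _ /=.
rewrite mul_diag_mx !mxE mulrBr !mulr_sumr -sumrN -!big_split.
by apply: eq_bigr => j _ /=; rewrite (Gs i j) (Ss i j) /H; ring.
Qed.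

(** As [Pi_a G] is [G] below the diagonal and [- G] above it, every summand is
    [|mu_i - mu_j| G_ij^2], and a nonzero off-diagonal entry makes one of them positive. *)
Lemma mxtrace_Toda_gt0 (R : realType) n (mu : 'I_n -> R) (G : 'M[R]_n) :
  (forall i j : 'I_n, (i < j)%N -> mu j < mu i) ->
  G^T = G -> ~ diagonal_mx_p G ->
  0 < \tr (diag_mx (\row_i mu i) *m commutator G (Pi_a G)).
Proof.
move=> mu_dec symG /existsNP[i /existsNP[j /not_implyP[ij /eqP Gij]]].
have H0 a b : 0 <= (mu a - mu b) * - (G a b * Pi_a G a b).
  have Gs : G b a = G a b by rewrite -[in LHS]symG mxE.
  rewrite mxE; case: ltngtP => [ba|ab|_]; last by rewrite mulr0 oppr0 mulr0.
    by rewrite mulrN -mulNr opprB -expr2 mulr_ge0 ?sqr_ge0 // subr_ge0 ltW // mu_dec.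
  by rewrite Gs [G a b * _]mulrN opprK -expr2 mulr_ge0 ?sqr_ge0 // subr_ge0 ltW // mu_dec.
rewrite mxtrace_Toda_sum // lt_neqAle eq_sym; apply/andP; split; last first.
  by do 2![apply: sumr_ge0 => ? _].
rewrite psumr_neq0; last by move=> *; apply: sumr_ge0.
apply/hasP; exists i; rewrite ?mem_index_enum //=.
rewrite lt_neqAle sumr_ge0 // andbT eq_sym psumr_neq0 //.
apply/hasP; exists j; rewrite ?mem_index_enum //= lt_neqAle H0 andbT eq_sym.
rewrite mulf_neq0 ?oppr_eq0 ?mulf_neq0 ?Gij //.
  rewrite subr_eq0; move: ij; rewrite neq_ltn => /orP[] /mu_dec.
    by move/gt_eqF ->.
  by move/lt_eqF ->.
have Gs : G j i = G i j by rewrite -[in LHS]symG mxE.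
by rewrite mxE; move: ij; rewrite neq_ltn; case: ltngtP; rewrite ?Gs ?oppr_eq0.
Qed.

(** * From a diagonal [f(T)] back to a diagonal [T] *)

Lemma spectral_decomp_eigenvalue (R : realType) n (A : 'M[R]_n) p k :
  spectral_decomp A p -> eigenvalue A (p.2 0 k).
Proof.
case: p => Q d [/= QQ ->]; have QQ' : Q^T *m Q = 1%:M by apply: mulmx1C.
apply/eigenvalueP; exists (row k Q^T).
  rewrite !mulmxA -!row_mul QQ' mul1mx.
  by apply/rowP => j; rewrite mul_diag_mx !mxE.
apply/eqP => r0; have := congr1 (fun v => (v *m Q) 0 k) r0.
by rewrite -row_mul QQ' mul0mx !mxE eqxx => /eqP; rewrite oner_eq0.
Qed.

(** Comparing [G Q] with [Q f(D)] shows that [f] takes the value [G_ii] at every eigenvalue met by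
    row [i] of [Q], so by injectivity these coincide. An entry [T_ij] is then that eigenvalue times
    [(Q Q^T)_ij], which vanishes off the diagonal. *)
Lemma diagonal_matfun (R : realType) n (f : R -> R) (T : 'M[R]_n) :
  T^T = T -> {in eigenvalue T &, injective f} ->
  diagonal_mx_p (matfun f T) -> diagonal_mx_p T.
Proof.
move=> symT injf; have [[Q d] dT ->] := matfunP f symT.
have ev k : eigenvalue T (d 0 k) := spectral_decomp_eigenvalue k dT.
case: dT => /= QQ TE; set G := _ *m _ *m _ => diagG.
have QQ' : Q^T *m Q = 1%:M by apply: mulmx1C.
have fG i k : Q i k != 0 -> f (d 0 k) = G i i.
  move=> Qik; have : (G *m Q) i k = Q i k * f (d 0 k).
    by rewrite /G -mulmxA QQ' mulmx1 mul_mx_diag !mxE.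
  rewrite mxE (bigD1 i) //= big1 ?addr0 => [|j ji]; last first.
    by rewrite diagG ?mul0r // eq_sym.
  by rewrite mulrC => /(mulfI Qik).
move=> i j ij.
have TijE : T i j = \sum_k Q i k * Q j k * d 0 k.
  by rewrite TE mul_mx_diag mxE; apply: eq_bigr => k _; rewrite !mxE; ring.
have [k0 Qk0|Q0] := pickP (fun k => Q i k * Q j k != 0); last first.
  by rewrite TijE big1 // => k _; rewrite (eqP (negbFE (Q0 k))) mul0r.
have -> : T i j = (Q *m Q^T) i j * d 0 k0.
  rewrite TijE mxE mulr_suml; apply: eq_bigr => k _; rewrite [Q^T _ _]mxE.
  have [->|Qk] := eqVneq (Q i k * Q j k) 0; first by rewrite !mul0r.
  move: Qk Qk0; rewrite !mulf_eq0 !negb_or => /andP[Qik _] /andP[Qik0 _].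
  by congr (_ * _); apply: injf; [exact: ev | exact: ev | rewrite (fG i k) // (fG i k0)].
by rewrite QQ mxE (negbTE ij) mul0r.
Qed.

Theorem theorem2p7 (R : realType) (n : nat) (lam mu : 'I_n -> R) (g : R -> R) :
  (forall i j : 'I_n, (i < j)%N -> lam i < lam j) ->
  (forall i j : 'I_n, (i < j)%N -> mu j < mu i) ->
  smooth_fun g ->
  (forall i j : 'I_n, i != j -> g (lam i) != g (lam j)) ->
  forall T : 'M[R]_n, in_T_Lambda lam T -> ~ diagonal_mx_p T ->
  let f := fun t : R => h_Mg mu g (T + t *: X_g g T) in
  derivable f 0 1 /\ 0 < f^`() 0.
Proof.
move=> _ mu_dec smooth_g g_inj T [symT [_ specT]] ndT f.
set M := diag_mx (\row_i mu i).
have [k fk] := matfun_commutator_expansion M (smooth_g 0%N) (smooth_g 1%N)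
  symT (Pi_a_skew (matfun g T)).
have [|df ->] := @derive1_of_quadratic_error _ f
    (\tr (M *m commutator (matfun g T) (Pi_a (matfun g T)))) k.
  move=> t /fk; rewrite /f /h_Mg scale0r addr0 -/M /X_g.
  move: (commutator (matfun g T) _) (matfun g (T + _)) => Y Z.
  by rewrite 2!mulmxBr 2!raddfB /= -scalemxAr mxtraceZ.
split=> //; apply: mxtrace_Toda_gt0 => //; first exact: matfun_sym.
(* Since [specT] lists the eigenvalues as values of [lam], the separation of [g] there gives
   injectivity on the spectrum. *)
apply: contra_not ndT; apply: diagonal_matfun => // a b.
move=> /specT[i ->] /specT[j ->] gij.
have [->//|/g_inj] := eqVneq i j.
by rewrite gij eqxx.
Qed.
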